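(* Let $n,k$ be positive integers with $k<\frac n2$, and let $a\leq\frac{n}{2}$ be a positive integer distinct from $1$ and $k$. Then the vector $$x_a=e_{\mathcal{F}_{\mathrm{id}}}-e_{\mathcal{F}_{\tau_1}}-e_{\mathcal{F}_{\tau_{a+1}}}+e_{\mathcal{F}_{\tau_1\tau_{a+1}}}$$ lies in the kernel of the $(n,k)$-wreath matrix $M$.
   Context: $\mathbb{Z}_n$ is the set of integers modulo $n$ and $\mathbb{Z}_n^{(k)}$ is the set of its $k$-element subsets. For a bijection $\pi:\mathbb{Z}_n\to\mathbb{Z}_n$, let $\mathcal{F}_\pi=\{\{\pi((i-1)k+1),\ldots,\pi(ik)\} : i\in\mathbb{Z}_n\}\subset\mathbb{Z}_n^{(k)}$ (arguments modulo $n$). An $(n,k)$-wreath is a family of the form $\mathcal{F}_\pi$; $\mathcal{W}_{n,k}$ is the set of all of them. The $(n,k)$-wreath matrix $M$ has rows and columns labelled by $\mathcal{W}_{n,k}$ and entries $M_{\mathcal{F},\mathcal{F}'}=|\mathcal{F}\cap\mathcal{F}'|$. It acts on the complex vector space $V$ with basis $\{e_{\mathcal{F}}:\mathcal{F}\in\mathcal{W}_{n,k}\}$. Here $\mathrm{id}$ is the identity permutation of $\mathbb{Z}_n$ and $\tau_i$ denotes the transposition swapping $i$ and $i+1$ in $\mathbb{Z}_n$. *)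

(* Defs.v *)
From HB Require Import structures.
From mathcomp Require Import all_boot all_order all_algebra all_fingroup.
From mathcomp Require Import reals complex.

Set Implicit Arguments.
Unset Strict Implicit.
Unset Printing Implicit Defensive.

Import GRing.Theory.
Local Open Scope ring_scope.

(* 'Z_n is the integers modulo n only when 1 < n; this is forced by the
   hypotheses 0 < k and 2k < n under which wreaths are used. *)

(* 'I_k starts at 0, hence the index j.+1 in 1..k. *)
Definition wreath_family (n k : nat) (p : {perm 'Z_n}) : {set {set 'Z_n}} :=
  [set [set p ((i - 1) * k%:R + (j.+1)%:R) | j : 'I_k] | i : 'Z_n].

Definition wreaths (n k : nat) : {set {set {set 'Z_n}}} :=
  [set wreath_family k p | p : {perm 'Z_n}].

Definition wreath (n k : nat) : finType := {F | F \in wreaths n k}.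

Lemma wreath_family_in (n k : nat) (p : {perm 'Z_n}) :
  wreath_family k p \in wreaths n k.
Proof. exact: imset_f. Qed.

Definition wreath_of (n k : nat) (p : {perm 'Z_n}) : wreath n k :=
  exist _ (wreath_family k p) (wreath_family_in k p).

(* Rows and columns are labelled by wreaths through the bijection enum_val. *)
Definition wreath_mx (R : realType) (n k : nat) : 'M[R[i]]_#|wreath n k| :=
  \matrix_(i, j) #|val (enum_val i) :&: val (enum_val j)|%:R.

Definition wreath_basis (R : realType) (n k : nat) (F : wreath n k) :
    'cV[R[i]]_#|wreath n k| :=
  delta_mx (enum_rank F) 0.

Definition tau (n : nat) (i : 'Z_n) : {perm 'Z_n} := tperm i (i + 1).

(* The product of permutations applies its left factor first; the two
   transpositions below are disjoint for 1 < a and 2a <= n, so the order is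
   immaterial. *)
Definition wreath_x (R : realType) (n k a : nat) : 'cV[R[i]]_#|wreath n k| :=
  let e p := wreath_basis R (wreath_of k p) in
  let t1 : {perm 'Z_n} := tau 1 in
  let ta : {perm 'Z_n} := tau (a.+1)%:R in
  e 1%g - e t1 - e ta + e (t1 * ta)%g.

(* Main.v *)
Require Import Defs.
From mathcomp Require Import all_boot all_order all_algebra all_fingroup.
From mathcomp Require Import reals complex.
From mathcomp Require Import zify.

Set Implicit Arguments.
Unset Strict Implicit.
Unset Printing Implicit Defensive.

Import GRing.Theory.
Local Open Scope ring_scope.

(** The wreath of a permutation [p] is the image under [p] of the wreath of the
identity, whose members are arcs (cyclic intervals) of length [k].  Counting
the members of a fixed family [F] in each of the four wreaths, an arc [A]
contributes the mixed second difference
[[A \in F] - [t A \in F] - [u A \in F] + [u t A \in F]], where [t] swaps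
1 and 2 and [u] swaps [a+1] and [a+2].  As [t] and [u] commute, this vanishes
as soon as [t] or [u] maps [A] to itself ([card_setI_commuting_perms]).

A swap of [x] and [x+1] moves an arc only if [x] is one of its two ends: the
point just before its first element, or its last element ([arc_boundary]).
These ends differ by [k], whereas the two swaps sit at distance [a]; if both
moved the same arc then [a] would be 0, [k] or [-k] modulo [n].  This is
excluded by [a <> k] together with [0 < a], [2a <= n] and [2k < n], so every arc
contributes zero.  The swaps commute, being disjoint by [1 < a] and [2a <= n]. *)

Lemma imset_tperm_id (T : finType) (x y : T) (A : {set T}) :
  (x \in A) = (y \in A) -> tperm x y @: A = A.
Proof.
move=> xyA; apply/setP=> z.
rewrite -[z in LHS](tpermK x y) mem_imset; last exact: perm_inj.
by case: tpermP => [->|->|].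
Qed.

Lemma imset_permM (T : finType) (p q : {perm T}) (A : {set T}) :
  (p * q)%g @: A = q @: (p @: A).
Proof. by rewrite -imset_comp; apply: eq_imset => z; rewrite permM. Qed.

Lemma card_setI_imset_perm (T : finType) (F B : {set {set T}}) (p : {perm T}) :
  #|F :&: [set p @: A | A : {set T} in B]|
    = (\sum_(A in B) (p @: A \in F))%N.
Proof.
rewrite setIC -sum1_card; under eq_bigl do rewrite inE.
rewrite big_mkcondr big_imset /=; last first.
  by move=> A A' _ _; apply/imset_inj/perm_inj.
by apply: eq_bigr => A _; case: (_ \in F).
Qed.

(** The mixed second difference over [B] vanishes term by term: for a set fixed
by one of the two permutations, applying it or not makes no difference, and
commutation allows it to be applied first. *)
Lemma card_setI_commuting_perms (T : finType) (F B : {set {set T}})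
    (t u : {perm T}) :
  commute t u ->
  (forall A, A \in B -> t @: A = A \/ u @: A = A) ->
  (#|F :&: [set (1%g : {perm T}) @: A | A : {set T} in B]|
     + #|F :&: [set (t * u)%g @: A | A : {set T} in B]|
   = #|F :&: [set t @: A | A : {set T} in B]|
     + #|F :&: [set u @: A | A : {set T} in B]|)%N.
Proof.
move=> tuC fixB; rewrite !card_setI_imset_perm -!big_split /=.
apply: eq_bigr => A /fixB fixA.
have ->: (1%g : {perm T}) @: A = A.
  by rewrite -[RHS]imset_id; apply: eq_imset => z; rewrite perm1.
by case: fixA => fixA; [|rewrite tuC]; rewrite imset_permM !fixA // addnC.
Qed.

(** Based at the point preceding its first element, so that its two ends, in the
sense of [arc_boundary], are [s] and [s + k]. *)
Definition arc (n k : nat) (s : 'Z_n) : {set 'Z_n} :=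
  [set s + (j.+1)%:R | j : 'I_k].

Lemma wreath_family_arcs (n k : nat) (p : {perm 'Z_n}) :
  wreath_family k p =
    [set p @: A | A : {set 'Z_n} in [set arc k ((i - 1) * k%:R) | i : 'Z_n]].
Proof.
by rewrite -imset_comp; apply: eq_imset => i /=; rewrite -imset_comp.
Qed.

(** The step from [s + j] to [s + j + 1] stays inside the arc for [0 < j < k],
so membership can only change at [j = k], on leaving, or at [j = 0], on
entering. *)
Lemma arc_boundary (n k : nat) (s x : 'Z_n) :
  (x \in arc k s) != (x + 1 \in arc k s) -> x = s \/ x = s + k%:R.
Proof.
case: (boolP (x \in arc k s)) => xA; case: (boolP (x + 1 \in arc k s)) => // yA _.
  right; case/imsetP: xA yA => j _ -> yA.
  have := ltn_ord j; rewrite leq_eqVlt => /predU1P[-> //|ltjk].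
  case/negP: yA; rewrite -addrA natr1.
  by apply/imsetP; exists (Ordinal ltjk).
left; case/imsetP: yA xA => -[[|j] ltjk] _ /=; first by move/addIr.
rewrite -natr1 addrA => /addIr -> /imsetP[].
by exists (Ordinal (ltnW ltjk)).
Qed.

Lemma tau_arc_boundary (n k : nat) (s x : 'Z_n) :
  tau x @: arc k s = arc k s \/ x = s \/ x = s + k%:R.
Proof.
by have [/imset_tperm_id|/arc_boundary] :=
  eqVneq (x \in arc k s) (x + 1 \in arc k s); [left | right].
Qed.

(** If both swaps moved the arc, [x] and [x + d] would both be ends of it; they
are distinct by [d != 0], and the ends are [k] apart in one direction or the
other. *)
Lemma tau_tau_arc (n k : nat) (s x d : 'Z_n) :
  d != 0 -> d != k%:R -> d + k%:R != 0 ->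
  tau x @: arc k s = arc k s \/ tau (x + d) @: arc k s = arc k s.
Proof.
move=> d0 dk dNk.
case: (tau_arc_boundary k s x) => [|xE]; first by left.
case: (tau_arc_boundary k s (x + d)) => [|yE]; first by right.
case: xE yE => -> [] /eqP.
- by rewrite -subr_eq0 addrAC subrr add0r (negPf d0).
- by rewrite (inj_eq (addrI s)) (negPf dk).
- by rewrite -addrA -[eqbRHS]addr0 (inj_eq (addrI s)) addrC (negPf dNk).
- by rewrite -subr_eq0 addrAC subrr add0r (negPf d0).
Qed.

Lemma tau_commute (n : nat) (x y : 'Z_n) :
  x != y -> x != y + 1 -> x + 1 != y -> commute (tau x) (tau y).
Proof.
move=> xy xy1 x1y; apply/commgP/conjg_fixP.
rewrite /tau tpermJ !tpermD // 1?eq_sym //.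
by rewrite (inj_eq (addIr 1)).
Qed.

Lemma Zp_natr_eq0 (n m : nat) : (1 < n)%N -> (m%:R == 0 :> 'Z_n) = (n %| m)%N.
Proof. by move=> n1; rewrite -val_eqE /= val_Zp_nat. Qed.

Lemma wreath_mx_basis (R : realType) (n k : nat) (p : {perm 'Z_n}) i j :
  (wreath_mx R n k *m wreath_basis R (wreath_of k p)) i j
    = #|val (enum_val i) :&: wreath_family k p|%:R.
Proof. by rewrite [j]ord1 -colE !mxE enum_rankK. Qed.

Theorem lemma5p1 (R : realType) (n k a : nat)
    (n_gt0 : (0 < n)%N) (k_gt0 : (0 < k)%N) (k_lt_half : (2 * k < n)%N)
    (a_gt0 : (0 < a)%N) (a_le_half : (2 * a <= n)%N)
    (a_neq1 : a <> 1%N) (a_neqk : a <> k) :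
  wreath_mx R n k *m wreath_x R n k a = 0.
Proof.
have a_gt1 : (1 < a)%N by lia.
have n_gt1 : (1 < n)%N by lia.
have natr_neq0 m : (0 < m < n)%N -> m%:R != 0 :> 'Z_n.
  by case/andP=> m0 mn; rewrite Zp_natr_eq0 // gtnNdvd.
have aS : a.+1%:R = 1 + a%:R :> 'Z_n by rewrite -nat1r.
have tauC : commute (tau (1 : 'Z_n)) (tau a.+1%:R).
  apply: tau_commute; rewrite aS.
  - by rewrite -subr_eq0 opprD addNKr oppr_eq0 natr_neq0; lia.
  - by rewrite -addrA -subr_eq0 opprD addNKr oppr_eq0 natr1 natr_neq0; lia.
  - rewrite (inj_eq (addrI 1)) eq_sym -subr_eq0 -(natrB _ a_gt0) natr_neq0 //.
    by lia.
have fixed A : A \in [set arc k ((i - 1) * k%:R) | i : 'Z_n] ->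
    tau 1 @: A = A \/ tau a.+1%:R @: A = A.
  case/imsetP=> i _ ->; rewrite aS; apply: tau_tau_arc.
  - by apply: natr_neq0; lia.
  - rewrite -val_eqE /= !val_Zp_nat // !modn_small; lia.
  - by rewrite -natrD natr_neq0; lia.
apply/matrixP=> r c; rewrite /wreath_x mulmxDr !mulmxBr [RHS]mxE [LHS]mxE.
have subE (A B : 'cV[R[i]]_#|wreath n k|) : (A - B) r c = A r c - B r c.
  by rewrite !mxE.
rewrite !subE !wreath_mx_basis !wreath_family_arcs.
rewrite addrAC [X in X - _]addrAC -[LHS]addrA -opprD -!natrD.
by rewrite (card_setI_commuting_perms _ tauC fixed) subrr.
Qed.
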